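(* For the discrete memoryless state-dependent multiaccess channel with degraded message sets described in the context, the capacity region $\mathcal C$ is contained in the closure of the set of all rate pairs $(R_c,R_1)$ for which there exists a joint distribution of the form $$P_{S,X_1,X_2,Y}=Q_S\,P_{X_1}\,P_{X_2|X_1,S}\,W_{Y|X_1,X_2,S}$$ such that $$R_1\le I(X_1;Y|S,X_2),\qquad R_c+R_1\le I(X_1,X_2;Y|S)-I(X_1;S|Y).$$
   Context: Finite alphabets $\mathcal S,\mathcal X_1,\mathcal X_2,\mathcal Y$. The channel is memoryless with transition law $W_{Y|X_1,X_2,S}$: for length-$n$ sequences, $P(y^n|x_1^n,x_2^n,s^n)=\prod_{i=1}^n W_{Y|X_1,X_2,S}(y_i|x_{1,i},x_{2,i},s_i)$. The state sequence $S^n$ is i.i.d. with law $Q_S$. Two independent messages, uniformly distributed and independent of $S^n$: a common message $W_c\in\{1,\dots,2^{nR_c}\}$ and an individual message $W_1\in\{1,\dots,2^{nR_1}\}$. A $(2^{nR_c},2^{nR_1},n)$-code consists of an encoder $\phi_1^n:\mathcal W_c\times\mathcal W_1\to\mathcal X_1^n$ at the ''uninformed'' encoder (which does not know the state), an encoder $\phi_2^n:\mathcal S^n\times\mathcal W_c\to\mathcal X_2^n$ at the ''informed'' encoder (which knows the whole state sequence $S^n$ non-causally and only the common message), and a decoder $\psi^n:\mathcal Y^n\to\mathcal W_c\times\mathcal W_1$; the decoder does not know the state. The error probability is $P_e^n=\Pr[\psi^n(Y^n)\ne(W_c,W_1)]$. A pair $(R_c,R_1)$ is achievable if there is a sequence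 of such codes with $P_e^n\to0$; the capacity region $\mathcal C$ is the closure of the set of achievable pairs. *)

(* Defs.v *)
(* real numbers, limits and logarithms from Stdlib Reals.
   Finite alphabets are {0,...,n-1} for a size n : nat; symbols are nats. *)
From Stdlib Require Import Reals List Arith ZArith Bool.
Open Scope R_scope.
Open Scope bool_scope.
Open Scope R_scope.

Definition sumR {A : Type} (f : A -> R) (l : list A) : R :=
  fold_right (fun a acc => f a + acc) 0 l.
Definition prodR {A : Type} (f : A -> R) (l : list A) : R :=
  fold_right (fun a acc => f a * acc) 1 l.

(* logarithm to base 2 (0 * log2 0 = 0 since ln is total with ln 0 = 0) *)
Definition log2 (x : R) : R := ln x / ln 2.

Definition is_pmf (n : nat) (p : nat -> R) : Prop :=
  (forall i, (i < n)%nat -> 0 <= p i) /\ sumR p (seq 0 n) = 1.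

Definition is_channel (nS nX1 nX2 nY : nat) (W : nat -> nat -> nat -> nat -> R) : Prop :=
  forall x1 x2 s, (x1 < nX1)%nat -> (x2 < nX2)%nat -> (s < nS)%nat ->
    is_pmf nY (fun y => W y x1 x2 s).

Record outc := mkOutc { oS : nat; oX1 : nat; oX2 : nat; oY : nat }.

Definition outcomes (nS nX1 nX2 nY : nat) : list outc :=
  flat_map (fun s => flat_map (fun a => flat_map (fun b =>
    map (fun y => mkOutc s a b y) (seq 0 nY)) (seq 0 nX2)) (seq 0 nX1)) (seq 0 nS).

(* a random variable is a function of the outcome with values in list nat *)
Definition leqb (l1 l2 : list nat) : bool :=
  if list_eq_dec Nat.eq_dec l1 l2 then true else false.
Definition sameV (V : outc -> list nat) (o o' : outc) : bool := leqb (V o) (V o').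

Definition prob (Om : list outc) (P : outc -> R) (ev : outc -> bool) : R :=
  sumR (fun o => if ev o then P o else 0) Om.

Definition cond_mi (Om : list outc) (P : outc -> R) (A B C : outc -> list nat) : R :=
  sumR (fun o =>
    let pABC := prob Om P (fun o' => sameV A o o' && sameV B o o' && sameV C o o') in
    let pAC  := prob Om P (fun o' => sameV A o o' && sameV C o o') in
    let pBC  := prob Om P (fun o' => sameV B o o' && sameV C o o') in
    let pC   := prob Om P (fun o' => sameV C o o') in
    P o * log2 ((pABC * pC) / (pAC * pBC))) Om.

Definition rvS (o : outc) : list nat := oS o :: nil.
Definition rvX1 (o : outc) : list nat := oX1 o :: nil.
Definition rvY (o : outc) : list nat := oY o :: nil.
Definition rvX1X2 (o : outc) : list nat := oX1 o :: oX2 o :: nil.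
Definition rvSX2 (o : outc) : list nat := oS o :: oX2 o :: nil.

Definition jointP (Q PX1 : nat -> R) (PX2 : nat -> nat -> nat -> R)
  (W : nat -> nat -> nat -> nat -> R) (o : outc) : R :=
  Q (oS o) * PX1 (oX1 o) * PX2 (oX2 o) (oX1 o) (oS o) * W (oY o) (oX1 o) (oX2 o) (oS o).

Definition outer_set (nS nX1 nX2 nY : nat) (Q : nat -> R)
  (W : nat -> nat -> nat -> nat -> R) (Rc R1 : R) : Prop :=
  exists (PX1 : nat -> R) (PX2 : nat -> nat -> nat -> R),
    is_pmf nX1 PX1 /\
    (forall x1 s, (x1 < nX1)%nat -> (s < nS)%nat -> is_pmf nX2 (fun x2 => PX2 x2 x1 s)) /\
    let Om := outcomes nS nX1 nX2 nY in
    let P := jointP Q PX1 PX2 W in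
    R1 <= cond_mi Om P rvX1 rvY rvSX2 /\
    Rc + R1 <= cond_mi Om P rvX1X2 rvY rvS - cond_mi Om P rvX1 rvS rvY.

Definition closure2 (A : R -> R -> Prop) (x y : R) : Prop :=
  forall eps, 0 < eps -> exists a b, A a b /\ Rabs (a - x) < eps /\ Rabs (b - y) < eps.

Fixpoint allseqs (a n : nat) : list (list nat) :=
  match n with
  | O => nil :: nil
  | S m => flat_map (fun x => map (cons x) (allseqs a m)) (seq 0 a)
  end.

Definition valid_seq (a n : nat) (x : list nat) : Prop :=
  length x = n /\ Forall (fun c => (c < a)%nat) x.

Definition Qn (Q : nat -> R) (s : list nat) : R := prodR Q s.

Definition Wn (W : nat -> nat -> nat -> nat -> R) (n : nat) (y x1 x2 s : list nat) : R :=
  prodR (fun i => W (nth i y O) (nth i x1 O) (nth i x2 O) (nth i s O)) (seq 0 n).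

(* number of messages: ceiling of 2^{nR} *)
Definition msg_size (n : nat) (r : R) : nat :=
  Z.to_nat (- Int_part (- Rpower 2 (INR n * r)))%Z.

(* average error probability, messages uniform on {0..Mc-1} x {0..M1-1},
   independent of the i.i.d. state.
   phi1 wc w1 : X1^n ; phi2 s wc : X2^n ; psi y : (wc, w1) *)
Definition err_prob (nS nY : nat) (Q : nat -> R) (W : nat -> nat -> nat -> nat -> R)
  (n Mc M1 : nat) (phi1 : nat -> nat -> list nat) (phi2 : list nat -> nat -> list nat)
  (psi : list nat -> nat * nat) : R :=
  / (INR Mc * INR M1) *
  sumR (fun wc => sumR (fun w1 => sumR (fun s => Qn Q s *
     sumR (fun y => Wn W n y (phi1 wc w1) (phi2 s wc) s *
        (if Nat.eqb (fst (psi y)) wc && Nat.eqb (snd (psi y)) w1 then 0 else 1))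
       (allseqs nY n)) (allseqs nS n)) (seq 0 M1)) (seq 0 Mc).

Definition achievable (nS nX1 nX2 nY : nat) (Q : nat -> R)
  (W : nat -> nat -> nat -> nat -> R) (Rc R1 : R) : Prop :=
  0 <= Rc /\ 0 <= R1 /\
  exists (phi1 : nat -> nat -> nat -> list nat)
         (phi2 : nat -> list nat -> nat -> list nat)
         (psi : nat -> list nat -> nat * nat),
    (forall n wc w1, (wc < msg_size n Rc)%nat -> (w1 < msg_size n R1)%nat ->
        valid_seq nX1 n (phi1 n wc w1)) /\
    (forall n s wc, valid_seq nS n s -> (wc < msg_size n Rc)%nat ->
        valid_seq nX2 n (phi2 n s wc)) /\
    Un_cv (fun n => err_prob nS nY Q W n (msg_size n Rc) (msg_size n R1)
                      (phi1 n) (phi2 n) (psi n)) 0.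

Definition capacity_region (nS nX1 nX2 nY : nat) (Q : nat -> R)
  (W : nat -> nat -> nat -> nat -> R) : R -> R -> Prop :=
  closure2 (achievable nS nX1 nX2 nY Q W).

(* Main.v *)
Require Import Defs.
From Stdlib Require Import Reals List Arith ZArith Bool.
From Stdlib Require Import Lra Lia Btauto.
Open Scope R_scope.

(** Let P be the law of (S_i, X_1i, X_2i, Y_i) averaged over the time index i. Since
    the uninformed encoder ignores the state, P factors as Q P_X1 P_{X2|X1,S} W. Each of the
    two single-letter expressions, evaluated at P and multiplied by n, is then exactly the
    relative entropy between the law of (W_c, W_1, S^n, Y^n) and a reference measure r:
    for the sum rate, r is uniform in the messages times
    prod_i P_Y(y_i) P_{S|X1,Y}(s_i | x_1i, y_i); for R_1, it is the true law of
    (W_c, W_1, S^n) times prod_i P_{Y|S,X2}(y_i | s_i, x_2i). Under r the decoder succeeds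
    with probability at most 1/(M_c M_1), resp. 1/M_1, so testing on the event of correct
    decoding bounds both relative entropies from below by (1 - P_e) log M - 1. *)

(** * Indicators and elementary real arithmetic *)

Definition indic (b : bool) : R := if b then 1 else 0.

Lemma indic_nonneg b : 0 <= indic b.
Proof. destruct b; simpl; lra. Qed.

Lemma indic_le1 b : indic b <= 1.
Proof. destruct b; simpl; lra. Qed.

Lemma indic_andb a b : indic (a && b) = indic a * indic b.
Proof. destruct a, b; simpl; lra. Qed.

Lemma Rdiv_nonneg x y : 0 <= x -> 0 <= y -> 0 <= x / y.
Proof.
  intros Hx [Hy|<-].
  - apply Rmult_le_pos; [exact Hx|]. now apply Rlt_le, Rinv_0_lt_compat.
  - unfold Rdiv. rewrite Rinv_0. lra.
Qed.

(** Only an inequality, because [0 / 0] evaluates to 0. Conditional laws obtained by division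
    therefore have total mass 0, not 1, when the conditioning event is null. *)
Lemma Rdiv_self_le1 x : x / x <= 1.
Proof.
  destruct (Req_dec x 0) as [->|Hx].
  - unfold Rdiv. rewrite Rmult_0_l. lra.
  - unfold Rdiv. rewrite Rinv_r by exact Hx. lra.
Qed.

Lemma log2_minus a b : 0 < a -> 0 < b -> log2 a - log2 b = log2 (a / b).
Proof.
  intros Ha Hb. unfold log2, Rdiv at 4. rewrite ln_mult, ln_Rinv; auto.
  - lra.
  - now apply Rinv_0_lt_compat.
Qed.

(** * Finite sums and products *)

Lemma sumR_ext_in {A} (f g : A -> R) l :
  (forall x, In x l -> f x = g x) -> sumR f l = sumR g l.
Proof.
  induction l as [|a l IH]; simpl; intros H; [reflexivity|].
  rewrite (H a), IH; auto.
Qed.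

Lemma sumR_app {A} (f : A -> R) l1 l2 : sumR f (l1 ++ l2) = sumR f l1 + sumR f l2.
Proof. induction l1 as [|a l IH]; simpl; [|rewrite IH]; lra. Qed.

Lemma sumR_map {A B} (h : A -> B) (f : B -> R) l : sumR f (map h l) = sumR (fun x => f (h x)) l.
Proof. induction l as [|a l IH]; simpl; [|rewrite IH]; reflexivity. Qed.

Lemma sumR_flat_map {A B} (h : A -> list B) (f : B -> R) l :
  sumR f (flat_map h l) = sumR (fun x => sumR f (h x)) l.
Proof. induction l as [|a l IH]; simpl; [|rewrite sumR_app, IH]; reflexivity. Qed.

Lemma sumR_list_prod {A B} (f : A * B -> R) l1 l2 :
  sumR f (list_prod l1 l2) = sumR (fun a => sumR (fun b => f (a, b)) l2) l1.
Proof.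
  induction l1 as [|a l IH]; simpl; [reflexivity|].
  rewrite sumR_app, sumR_map, IH; reflexivity.
Qed.

Lemma sumR_0 {A} (l : list A) : sumR (fun _ => 0) l = 0.
Proof. induction l as [|a l IH]; simpl; [|rewrite IH]; lra. Qed.

Lemma sumR_plus {A} (f g : A -> R) l : sumR (fun x => f x + g x) l = sumR f l + sumR g l.
Proof. induction l as [|a l IH]; simpl; [|rewrite IH]; lra. Qed.

Lemma sumR_scal {A} c (f : A -> R) l : sumR (fun x => c * f x) l = c * sumR f l.
Proof. induction l as [|a l IH]; simpl; [|rewrite IH]; lra. Qed.

Lemma sumR_scal_r {A} c (f : A -> R) l : sumR (fun x => f x * c) l = sumR f l * c.
Proof. rewrite Rmult_comm, <- sumR_scal. apply sumR_ext_in. intros; lra. Qed.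

Lemma sumR_const {A} c (l : list A) : sumR (fun _ => c) l = INR (length l) * c.
Proof.
  induction l as [|a l IH]; [simpl; lra|].
  change (length (a :: l)) with (S (length l)). rewrite S_INR. simpl. rewrite IH. lra.
Qed.

Lemma sumR_exchange {A B} (f : A -> B -> R) l1 l2 :
  sumR (fun a => sumR (f a) l2) l1 = sumR (fun b => sumR (fun a => f a b) l1) l2.
Proof.
  induction l1 as [|a l IH]; simpl.
  - now rewrite sumR_0.
  - rewrite IH, <- sumR_plus; reflexivity.
Qed.

Lemma sumR_le {A} (f g : A -> R) l :
  (forall x, In x l -> f x <= g x) -> sumR f l <= sumR g l.
Proof.
  induction l as [|a l IH]; simpl; intros H; [lra|].
  pose proof (H a (or_introl eq_refl)). assert (sumR f l <= sumR g l) by auto. lra.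
Qed.

Lemma sumR_nonneg {A} (f : A -> R) l : (forall x, In x l -> 0 <= f x) -> 0 <= sumR f l.
Proof. intros H. rewrite <- (sumR_0 l). now apply sumR_le. Qed.

Lemma sumR_ge_term {A} (f : A -> R) l x :
  (forall y, In y l -> 0 <= f y) -> In x l -> f x <= sumR f l.
Proof.
  induction l as [|a l IH]; simpl; intros H Hin; [destruct Hin|].
  destruct Hin as [<-|Hx].
  - assert (0 <= sumR f l) by (apply sumR_nonneg; auto). lra.
  - assert (f x <= sumR f l) by auto. pose proof (H a (or_introl eq_refl)). lra.
Qed.

Lemma sumR_single {A} (f : A -> R) l k :
  NoDup l -> In k l -> (forall x, In x l -> x <> k -> f x = 0) -> sumR f l = f k.
Proof.
  induction l as [|a l IH]; intros Hnd Hin H; [destruct Hin|].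
  inversion Hnd as [|? ? Hna Hnd']; subst. simpl. destruct Hin as [->|Hin].
  - rewrite (sumR_ext_in _ (fun _ => 0)), sumR_0; [lra|].
    intros x Hx. apply H; [now right|]. now intros ->.
  - rewrite IH by (auto; intros; apply H; auto; now right).
    rewrite (H a); [lra|now left|]. now intros ->.
Qed.

Lemma sumR_delta (f : nat -> R) m k :
  (k < m)%nat -> sumR (fun v => indic (k =? v) * f v) (seq 0 m) = f k.
Proof.
  intros Hk. rewrite (sumR_single _ _ k).
  - rewrite Nat.eqb_refl; simpl; lra.
  - apply seq_NoDup.
  - apply in_seq; lia.
  - intros x _ Hx. destruct (Nat.eqb_spec k x); [congruence|simpl; lra].
Qed.

(** [k] may lie outside the range, as a decoder output is allowed to do; then no index matches and
    the sum is 0. *)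
Lemma sumR_indic_eqb_le1 k m : sumR (fun v => indic (k =? v)) (seq 0 m) <= 1.
Proof.
  destruct (lt_dec k m) as [Hk|Hk].
  - rewrite (sumR_ext_in _ (fun v => indic (k =? v) * 1)) by (intros; lra).
    rewrite (sumR_delta (fun _ => 1)) by auto. lra.
  - rewrite (sumR_ext_in _ (fun _ => 0)), sumR_0; [lra|].
    intros x Hx. apply in_seq in Hx. destruct (Nat.eqb_spec k x); [lia|reflexivity].
Qed.

Lemma prodR_ext_in {A} (f g : A -> R) l :
  (forall x, In x l -> f x = g x) -> prodR f l = prodR g l.
Proof.
  induction l as [|a l IH]; simpl; intros H; [reflexivity|].
  rewrite (H a), IH; auto.
Qed.

Lemma prodR_map {A B} (h : A -> B) (f : B -> R) l :
  prodR f (map h l) = prodR (fun x => f (h x)) l.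
Proof. induction l as [|a l IH]; simpl; [|rewrite IH]; reflexivity. Qed.

Lemma prodR_mult {A} (f g : A -> R) l : prodR (fun x => f x * g x) l = prodR f l * prodR g l.
Proof. induction l as [|a l IH]; simpl; [|rewrite IH]; lra. Qed.

Lemma prodR_nonneg {A} (f : A -> R) l : (forall x, In x l -> 0 <= f x) -> 0 <= prodR f l.
Proof.
  induction l as [|a l IH]; simpl; intros H; [lra|].
  apply Rmult_le_pos; auto.
Qed.

Lemma prodR_pos {A} (f : A -> R) l : (forall x, In x l -> 0 < f x) -> 0 < prodR f l.
Proof.
  induction l as [|a l IH]; simpl; intros H; [lra|].
  apply Rmult_lt_0_compat; auto.
Qed.

Lemma prodR_le1 {A} (f : A -> R) l : (forall x, In x l -> 0 <= f x <= 1) -> prodR f l <= 1.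
Proof.
  induction l as [|a l IH]; simpl; intros H; [lra|].
  assert (prodR f l <= 1) by auto.
  assert (0 <= prodR f l) by (apply prodR_nonneg; intros; apply H; auto).
  destruct (H a (or_introl eq_refl)). nra.
Qed.

Lemma prodR_1 {A} (f : A -> R) l : (forall x, In x l -> f x = 1) -> prodR f l = 1.
Proof.
  induction l as [|a l IH]; simpl; intros H; [lra|].
  rewrite (H a), IH; auto. lra.
Qed.

Lemma prodR_single {A} (f : A -> R) l k :
  NoDup l -> In k l -> (forall x, In x l -> x <> k -> f x = 1) -> prodR f l = f k.
Proof.
  induction l as [|a l IH]; intros Hnd Hin H; [destruct Hin|].
  inversion Hnd as [|? ? Hna Hnd']; subst. simpl. destruct Hin as [->|Hin].
  - rewrite prodR_1; [lra|].
    intros x Hx. apply H; [now right|]. now intros ->.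
  - rewrite IH by (auto; intros; apply H; auto; now right).
    rewrite (H a); [lra|now left|]. now intros ->.
Qed.

Lemma ln_prodR {A} (f : A -> R) l :
  (forall x, In x l -> 0 < f x) -> ln (prodR f l) = sumR (fun x => ln (f x)) l.
Proof.
  induction l as [|a l IH]; simpl; intros H; [apply ln_1|].
  rewrite ln_mult, IH; auto. apply prodR_pos; auto.
Qed.

(** * Sums over sequences *)

Lemma allseqs_valid a n s : In s (allseqs a n) -> valid_seq a n s.
Proof.
  revert s. induction n as [|n IH]; simpl; intros s Hs.
  - destruct Hs as [<-|[]]. now split.
  - apply in_flat_map in Hs. destruct Hs as [x [Hx Hs]].
    apply in_map_iff in Hs. destruct Hs as [t [<- Ht]].
    destruct (IH t Ht) as [Hl Hf]. apply in_seq in Hx.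
    split; simpl; [congruence|]. constructor; [lia|exact Hf].
Qed.

Lemma valid_seq_nth a n s i : valid_seq a n s -> (i < n)%nat -> (nth i s O < a)%nat.
Proof.
  intros [Hl Hf] Hi. rewrite Forall_forall in Hf. apply Hf, nth_In. lia.
Qed.

(** Distributivity, by induction on the first coordinate. It evaluates the total mass of every
    product measure on sequences used below. *)
Lemma sumR_allseqs_prod a n (g : nat -> nat -> R) :
  sumR (fun y => prodR (fun i => g i (nth i y O)) (seq 0 n)) (allseqs a n) =
  prodR (fun i => sumR (g i) (seq 0 a)) (seq 0 n).
Proof.
  revert g. induction n as [|n IH]; intros g; simpl; [lra|].
  rewrite sumR_flat_map, <- seq_shift, prodR_map, <- (IH (fun i => g (S i))).
  rewrite Rmult_comm, <- sumR_scal. apply sumR_ext_in. intros x _.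
  rewrite sumR_map, Rmult_comm, <- sumR_scal. apply sumR_ext_in. intros y _.
  rewrite prodR_map. reflexivity.
Qed.

(** The test function [h] is absorbed as an extra factor at coordinate [k]; after distributing,
    every other coordinate contributes the factor 1. *)
Lemma sumR_allseqs_marginal a n (g : nat -> nat -> R) (h : nat -> R) k :
  (forall i, (i < n)%nat -> sumR (g i) (seq 0 a) = 1) -> (k < n)%nat ->
  sumR (fun y => prodR (fun i => g i (nth i y O)) (seq 0 n) * h (nth k y O)) (allseqs a n) =
  sumR (fun v => g k v * h v) (seq 0 a).
Proof.
  intros Hg Hk.
  assert (Hin : In k (seq 0 n)) by (apply in_seq; lia).
  transitivity (sumR (fun y => prodR (fun i => g i (nth i y O) *
                  (if i =? k then h (nth i y O) else 1)) (seq 0 n)) (allseqs a n)).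
  - apply sumR_ext_in. intros y _. rewrite prodR_mult. f_equal.
    rewrite (prodR_single _ _ k (seq_NoDup _ _) Hin).
    + now rewrite Nat.eqb_refl.
    + intros i _ Hi. destruct (Nat.eqb_spec i k); [contradiction|reflexivity].
  - rewrite (sumR_allseqs_prod a n (fun i v => g i v * (if i =? k then h v else 1))).
    rewrite (prodR_single _ _ k (seq_NoDup _ _) Hin).
    + now rewrite Nat.eqb_refl.
    + intros i Hi Hik. transitivity (sumR (g i) (seq 0 a));
        [|apply Hg; apply in_seq in Hi; lia].
      apply sumR_ext_in. intros v _. destruct (Nat.eqb_spec i k); [contradiction|lra].
Qed.

Lemma Qn_nth Q n s : length s = n -> Qn Q s = prodR (fun i => Q (nth i s O)) (seq 0 n).
Proof.
  unfold Qn. revert n. induction s as [|x s IH]; intros n <-; simpl; [reflexivity|].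
  rewrite <- seq_shift, prodR_map, (IH (length s) eq_refl). reflexivity.
Qed.

Lemma Qn_nonneg nS Q n s : is_pmf nS Q -> In s (allseqs nS n) -> 0 <= Qn Q s.
Proof.
  intros HQ Hs. apply allseqs_valid in Hs as [_ Hf]. rewrite Forall_forall in Hf.
  apply prodR_nonneg. intros x Hx. apply HQ. auto.
Qed.

Lemma sumR_Qn_marginal nS Q n h k : is_pmf nS Q -> (k < n)%nat ->
  sumR (fun s => Qn Q s * h (nth k s O)) (allseqs nS n) = sumR (fun v => Q v * h v) (seq 0 nS).
Proof.
  intros [_ HQ] Hk.
  rewrite <- (sumR_allseqs_marginal nS n (fun _ => Q) h k) by auto.
  apply sumR_ext_in. intros s Hs. now rewrite (Qn_nth Q n) by apply (allseqs_valid _ _ _ Hs).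
Qed.

Lemma sumR_Qn nS Q n : is_pmf nS Q -> sumR (Qn Q) (allseqs nS n) = 1.
Proof.
  intros [_ HQ]. rewrite <- (prodR_1 (fun i => sumR Q (seq 0 nS)) (seq 0 n)) by auto.
  rewrite <- (sumR_allseqs_prod nS n (fun _ => Q)).
  apply sumR_ext_in. intros s Hs. apply Qn_nth, (allseqs_valid _ _ _ Hs).
Qed.

(** * A converse bound from a test between two measures *)

(* Gibbs' inequality for the sub-probability weight r * M^[ok] / 2, i.e. the
   Donsker-Varadhan bound for the relative entropy of p with respect to r. *)
Lemma divergence_test_bound {A} (Om : list A) (p r L : A -> R) (ok : A -> bool) (M : R) :
  0 < M ->
  (forall w, In w Om -> 0 <= p w) -> (forall w, In w Om -> 0 <= r w) ->
  sumR p Om = 1 ->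
  (forall w, In w Om -> 0 < p w -> exists z, 0 < z /\ L w = ln z /\ p w = r w * z) ->
  sumR r Om <= 1 ->
  sumR (fun w => r w * indic (ok w)) Om <= / M ->
  sumR (fun w => p w * indic (ok w)) Om * ln M - ln 2 <= sumR (fun w => p w * L w) Om.
Proof.
  intros HM Hp Hr Hp1 HL Hr1 Hok.
  (* Summed over [Om], the last two terms on the left contribute at least [- ln 2 + 1 - 1]: both the
     mass of [r] and [M] times its mass on [ok] are at most 1. *)
  assert (Hpt : forall w, In w Om ->
     p w * indic (ok w) * ln M + (- ln 2 + 1) * p w
       + (- / 2) * (r w + M * (r w * indic (ok w))) <= p w * L w).
  { intros w Hw. pose proof (Hp w Hw) as Hpw. pose proof (Hr w Hw) as Hrw.
    pose proof (indic_nonneg (ok w)) as Hi.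
    destruct Hpw as [Hpw|Hpw].
    - destruct (HL w Hw Hpw) as [z [Hz [-> Hpz]]].
      set (e := if ok w then M else 1).
      assert (He : 0 < e) by (unfold e; destruct (ok w); lra).
      assert (Hle : ln e = indic (ok w) * ln M).
      { unfold e; destruct (ok w); simpl; [lra|rewrite ln_1; lra]. }
      assert (Hx : 0 < e / (2 * z)) by (apply Rdiv_lt_0_compat; lra).
      assert (Hl : ln (e / (2 * z)) = ln e - ln 2 - ln z).
      { unfold Rdiv. rewrite ln_mult, ln_Rinv, ln_mult; try lra.
        apply Rinv_0_lt_compat; lra. }
      (* This is [ln x <= x - 1] at [x = e / (2 * z)], with [e] equal to [M] on [ok] and 1
         elsewhere. Since [p w = r w * z], multiplying by [p w] turns the right side into
         [r w * e / 2 - p w]. *)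
      assert (Hineq : ln (e / (2 * z)) <= e / (2 * z) - 1).
      { pose proof (exp_ineq1_le (ln (e / (2 * z)))) as H.
        rewrite exp_ln in H by exact Hx. lra. }
      assert (Hm : p w * ln (e / (2 * z)) <= p w * (e / (2 * z) - 1))
        by (apply Rmult_le_compat_l; lra).
      assert (Hr2 : p w * (e / (2 * z)) = / 2 * (r w * e))
        by (rewrite Hpz; field; lra).
      assert (Hee : r w * e <= r w + M * (r w * indic (ok w))).
      { unfold e; destruct (ok w); simpl; lra. }
      rewrite Hl, Hle in Hm. lra.
    - rewrite <- Hpw. assert (0 <= M * (r w * indic (ok w))).
      { apply Rmult_le_pos; [lra|]. now apply Rmult_le_pos. }
      lra. }
  apply sumR_le in Hpt. rewrite !sumR_plus, !sumR_scal, sumR_plus, sumR_scal, Hp1 in Hpt.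
  rewrite (sumR_ext_in (fun w => p w * indic (ok w) * ln M)
             (fun w => ln M * (p w * indic (ok w)))), sumR_scal in Hpt by (intros; lra).
  assert (M * sumR (fun w => r w * indic (ok w)) Om <= M * / M)
    by (apply Rmult_le_compat_l; lra).
  rewrite Rinv_r in H by lra. lra.
Qed.

(** * Single-letter marginals *)

Lemma in_outcomes nS nX1 nX2 nY o :
  In o (outcomes nS nX1 nX2 nY) <->
  (oS o < nS /\ oX1 o < nX1 /\ oX2 o < nX2 /\ oY o < nY)%nat.
Proof.
  unfold outcomes. destruct o as [s a b y]; simpl. split.
  - intros H. apply in_flat_map in H as [s' [Hs H]].
    apply in_flat_map in H as [a' [Ha H]]. apply in_flat_map in H as [b' [Hb H]].
    apply in_map_iff in H as [y' [E Hy]]. rewrite in_seq in *.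
    injection E as <- <- <- <-. lia.
  - intros (Hs & Ha & Hb & Hy).
    apply in_flat_map; exists s; rewrite in_seq; split; [lia|].
    apply in_flat_map; exists a; rewrite in_seq; split; [lia|].
    apply in_flat_map; exists b; rewrite in_seq; split; [lia|].
    apply in_map, in_seq; lia.
Qed.

Lemma sumR_outcomes nS nX1 nX2 nY (f : outc -> R) :
  sumR f (outcomes nS nX1 nX2 nY) =
  sumR (fun s => sumR (fun a => sumR (fun b => sumR (fun y => f (mkOutc s a b y))
    (seq 0 nY)) (seq 0 nX2)) (seq 0 nX1)) (seq 0 nS).
Proof.
  unfold outcomes. rewrite sumR_flat_map. apply sumR_ext_in; intros s _.
  rewrite sumR_flat_map. apply sumR_ext_in; intros a _.
  rewrite sumR_flat_map. apply sumR_ext_in; intros b _.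
  now rewrite sumR_map.
Qed.

Lemma leqb1 a b : leqb (a :: nil) (b :: nil) = (a =? b).
Proof.
  unfold leqb. destruct (list_eq_dec _ _ _) as [e|e], (Nat.eqb_spec a b); congruence.
Qed.

Lemma leqb2 a b c d : leqb (a :: b :: nil) (c :: d :: nil) = (a =? c) && (b =? d).
Proof.
  unfold leqb. destruct (list_eq_dec _ _ _) as [e|e], (Nat.eqb_spec a c), (Nat.eqb_spec b d);
    simpl; congruence.
Qed.

Lemma prob_indic Om P ev : prob Om P ev = sumR (fun o => indic (ev o) * P o) Om.
Proof. apply sumR_ext_in. intros o _. destruct (ev o); simpl; lra. Qed.

Lemma prob_ext Om P ev ev' : (forall o, ev o = ev' o) -> prob Om P ev = prob Om P ev'.
Proof. intros H. apply sumR_ext_in. intros o _. now rewrite H. Qed.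

Lemma prob_nonneg Om P ev : (forall o, In o Om -> 0 <= P o) -> 0 <= prob Om P ev.
Proof.
  intros H. apply sumR_nonneg. intros o Ho. destruct (ev o); [auto|lra].
Qed.

Lemma prob_ge_point Om P (ev : outc -> bool) o :
  (forall o, In o Om -> 0 <= P o) -> In o Om -> ev o = true -> P o <= prob Om P ev.
Proof.
  intros H Ho E.
  pose proof (sumR_ge_term (fun o => if ev o then P o else 0) Om o) as Hg. simpl in Hg.
  rewrite E in Hg. apply Hg; [|exact Ho]. intros y Hy. destruct (ev y); [auto|lra].
Qed.

(** Law of total probability over the values of [f]: exchanging the sums leaves, for each outcome,
    exactly one matching value. It sums out one coordinate at a time below. *)
Lemma prob_partition Om P ev (f : outc -> nat) k :
  (forall o, In o Om -> (f o < k)%nat) ->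
  sumR (fun v => prob Om P (fun o => ev o && (v =? f o))) (seq 0 k) = prob Om P ev.
Proof.
  intros Hf. rewrite prob_indic.
  rewrite (sumR_ext_in _ (fun v => sumR (fun o => indic (f o =? v) * (indic (ev o) * P o)) Om)).
  - rewrite sumR_exchange. apply sumR_ext_in. intros o Ho.
    now rewrite (sumR_delta (fun _ => indic (ev o) * P o)) by auto.
  - intros v _. rewrite prob_indic. apply sumR_ext_in. intros o _.
    rewrite indic_andb, (Nat.eqb_sym v). lra.
Qed.

Definition probS Om P s := prob Om P (fun o => s =? oS o).
Definition probY Om P y := prob Om P (fun o => y =? oY o).
Definition probSX2 Om P s b := prob Om P (fun o => (s =? oS o) && (b =? oX2 o)).
Definition probSX2Y Om P s b y :=
  prob Om P (fun o => (s =? oS o) && (b =? oX2 o) && (y =? oY o)).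
Definition probX1Y Om P a y := prob Om P (fun o => (a =? oX1 o) && (y =? oY o)).
(** The state comparison comes last so that [prob_partition] sums it out directly, leaving the event
    of [probX1Y]. *)
Definition probSX1Y Om P s a y :=
  prob Om P (fun o => (a =? oX1 o) && (y =? oY o) && (s =? oS o)).

Section SingleLetter.

Context (nS nX1 nX2 nY : nat) (Q PX1 : nat -> R) (PX2 : nat -> nat -> nat -> R)
  (W : nat -> nat -> nat -> nat -> R)
  (HQ : is_pmf nS Q) (HW : is_channel nS nX1 nX2 nY W) (HPX1 : is_pmf nX1 PX1)
  (HPX2 : forall x1 s, (x1 < nX1)%nat -> (s < nS)%nat -> is_pmf nX2 (fun x2 => PX2 x2 x1 s)).

Let Om := outcomes nS nX1 nX2 nY.
Let P := jointP Q PX1 PX2 W.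

Lemma jointP_nonneg o : In o Om -> 0 <= P o.
Proof.
  intros Ho. apply in_outcomes in Ho as (Hs & Ha & Hb & Hy).
  unfold P, jointP. repeat apply Rmult_le_pos.
  - now apply HQ.
  - now apply HPX1.
  - now apply HPX2.
  - now apply (HW (oX1 o) (oX2 o) (oS o)).
Qed.

Lemma prob_point s a b y :
  (s < nS)%nat -> (a < nX1)%nat -> (b < nX2)%nat -> (y < nY)%nat ->
  prob Om P (fun o => (s =? oS o) && (a =? oX1 o) && (b =? oX2 o) && (y =? oY o))
  = P (mkOutc s a b y).
Proof.
  intros Hs Ha Hb Hy. rewrite prob_indic. unfold Om. rewrite sumR_outcomes. simpl.
  rewrite <- (sumR_delta (fun s => P (mkOutc s a b y)) nS s Hs).
  apply sumR_ext_in; intros s' _.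
  rewrite <- (sumR_delta (fun a => P (mkOutc s' a b y)) nX1 a Ha), <- sumR_scal.
  apply sumR_ext_in; intros a' _.
  rewrite <- (sumR_delta (fun b => P (mkOutc s' a' b y)) nX2 b Hb), <- !sumR_scal.
  apply sumR_ext_in; intros b' _.
  rewrite <- (sumR_delta (fun y => P (mkOutc s' a' b' y)) nY y Hy), <- !sumR_scal.
  apply sumR_ext_in; intros y' _.
  rewrite !indic_andb. ring.
Qed.

Lemma prob_SX1X2 s a b :
  (s < nS)%nat -> (a < nX1)%nat -> (b < nX2)%nat ->
  prob Om P (fun o => (s =? oS o) && (a =? oX1 o) && (b =? oX2 o))
  = Q s * PX1 a * PX2 b a s.
Proof.
  intros Hs Ha Hb. rewrite <- (prob_partition _ _ _ oY nY).
  - rewrite (sumR_ext_in _ (fun y => Q s * PX1 a * PX2 b a s * W y a b s)).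
    + rewrite sumR_scal. destruct (HW a b s Ha Hb Hs) as [_ ->]. lra.
    + intros y Hy. apply in_seq in Hy. now rewrite prob_point by lia.
  - intros o Ho. now apply in_outcomes in Ho.
Qed.

Lemma probS_jointP s : (s < nS)%nat -> probS Om P s = Q s.
Proof.
  intros Hs. unfold probS. rewrite <- (prob_partition _ _ _ oX1 nX1).
  - rewrite (sumR_ext_in _ (fun a => Q s * PX1 a)).
    + rewrite sumR_scal. destruct HPX1 as [_ ->]. lra.
    + intros a Ha. apply in_seq in Ha. rewrite <- (prob_partition _ _ _ oX2 nX2).
      * rewrite (sumR_ext_in _ (fun b => Q s * PX1 a * PX2 b a s)).
        -- rewrite sumR_scal. destruct (HPX2 a s) as [_ ->]; try lia. lra.
        -- intros b Hb. apply in_seq in Hb. now rewrite prob_SX1X2 by lia.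
      * intros o Ho. now apply in_outcomes in Ho.
  - intros o Ho. now apply in_outcomes in Ho.
Qed.

(** On the support, the joint mass of all four letters divided by that of the state and both inputs
    is [W], which removes two of the four probabilities in the information density. Outcomes of mass
    0 have weight 0 on both sides. *)
Lemma cond_mi_X1_Y_given_SX2 :
  cond_mi Om P rvX1 rvY rvSX2 =
  sumR (fun o => P o * log2 (W (oY o) (oX1 o) (oX2 o) (oS o) *
    probSX2 Om P (oS o) (oX2 o) / probSX2Y Om P (oS o) (oX2 o) (oY o))) Om.
Proof.
  apply sumR_ext_in. intros o Ho. cbv zeta.
  destruct (jointP_nonneg o Ho) as [Hpos|<-]; [|lra]. do 2 f_equal.
  pose proof Ho as Hr. apply in_outcomes in Hr as (Hs & Ha & Hb & Hy).
  rewrite (prob_ext _ _ _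
    (fun o' => (oS o =? oS o') && (oX1 o =? oX1 o') && (oX2 o =? oX2 o') && (oY o =? oY o')))
    by (intros o'; unfold sameV, rvX1, rvY, rvSX2; rewrite !leqb1, !leqb2; btauto).
  rewrite (prob_ext _ _ (fun o' => sameV rvSX2 o o')
    (fun o' => (oS o =? oS o') && (oX2 o =? oX2 o')))
    by (intros o'; unfold sameV, rvSX2; rewrite !leqb2; btauto).
  rewrite (prob_ext _ _ (fun o' => sameV rvX1 o o' && sameV rvSX2 o o')
    (fun o' => (oS o =? oS o') && (oX1 o =? oX1 o') && (oX2 o =? oX2 o')))
    by (intros o'; unfold sameV, rvX1, rvSX2; rewrite !leqb1, !leqb2; btauto).
  rewrite (prob_ext _ _ (fun o' => sameV rvY o o' && sameV rvSX2 o o')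
    (fun o' => (oS o =? oS o') && (oX2 o =? oX2 o') && (oY o =? oY o')))
    by (intros o'; unfold sameV, rvY, rvSX2; rewrite !leqb1, !leqb2; btauto).
  fold (probSX2 Om P (oS o) (oX2 o)). fold (probSX2Y Om P (oS o) (oX2 o) (oY o)).
  assert (0 < probSX2Y Om P (oS o) (oX2 o) (oY o)).
  { eapply Rlt_le_trans; [exact Hpos|]. apply prob_ge_point; auto using jointP_nonneg.
    now rewrite !Nat.eqb_refl. }
  rewrite prob_point, prob_SX1X2 by auto.
  assert (0 < Q (oS o) * PX1 (oX1 o) * PX2 (oX2 o) (oX1 o) (oS o)).
  { rewrite <- prob_SX1X2 by auto.
    eapply Rlt_le_trans; [exact Hpos|]. apply prob_ge_point; auto using jointP_nonneg.
    now rewrite !Nat.eqb_refl. }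
  unfold P at 1, jointP; simpl. field.
  repeat split; try lra; intros E; rewrite E in *; lra.
Qed.

(** The first density reduces to [W * Q] over the joint probability of [Y] and [S], because [S] has
    law [Q]. The second density contains the same joint probability in its denominator, so it
    cancels in the difference. *)
Lemma cond_mi_sum_rate :
  cond_mi Om P rvX1X2 rvY rvS - cond_mi Om P rvX1 rvS rvY =
  sumR (fun o => P o * log2 (W (oY o) (oX1 o) (oX2 o) (oS o) * Q (oS o) *
    probX1Y Om P (oX1 o) (oY o) /
    (probSX1Y Om P (oS o) (oX1 o) (oY o) * probY Om P (oY o)))) Om.
Proof.
  unfold cond_mi. unfold Rminus.
  replace (- sumR _ Om) with (-1 * sumR (fun o => P o * log2
    ((prob Om P (fun o' => sameV rvX1 o o' && sameV rvS o o' && sameV rvY o o') *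
      prob Om P (fun o' => sameV rvY o o')) /
     (prob Om P (fun o' => sameV rvX1 o o' && sameV rvY o o') *
      prob Om P (fun o' => sameV rvS o o' && sameV rvY o o')))) Om) by (cbv zeta; lra).
  rewrite <- sumR_scal, <- sumR_plus.
  apply sumR_ext_in. intros o Ho.
  destruct (jointP_nonneg o Ho) as [Hpos|<-]; [|lra].
  pose proof Ho as Hr. apply in_outcomes in Hr as (Hs & Ha & Hb & Hy).
  assert (Hev : forall ev, ev o = true -> 0 < prob Om P ev).
  { intros ev E. eapply Rlt_le_trans; [exact Hpos|].
    apply prob_ge_point; auto using jointP_nonneg. }
  assert (Hself : forall V, sameV V o o = true).
  { intros V. unfold sameV, leqb. destruct (list_eq_dec _ _ _); congruence. }
  (* The arguments of the two logarithms; both must be positive before their difference is merged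
     into one logarithm. *)
  set (t1 := prob _ _ _ * prob _ _ _ / _). set (t2 := prob _ _ _ * prob _ _ _ / _).
  assert (H1 : 0 < t1).
  { apply Rdiv_lt_0_compat; apply Rmult_lt_0_compat; apply Hev; now rewrite !Hself. }
  assert (H2 : 0 < t2).
  { apply Rdiv_lt_0_compat; apply Rmult_lt_0_compat; apply Hev; now rewrite !Hself. }
  replace (P o * log2 t1 + -1 * (P o * log2 t2)) with (P o * (log2 t1 - log2 t2)) by ring.
  rewrite log2_minus by auto. do 2 f_equal.
  assert (E1 : t1 = W (oY o) (oX1 o) (oX2 o) (oS o) * Q (oS o) /
     prob Om P (fun o' => sameV rvY o o' && sameV rvS o o')).
  { unfold t1. rewrite (prob_ext _ _ (fun o' => sameV rvX1X2 o o' && sameV rvY o o' && sameV rvS o o')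
     (fun o' => (oS o =? oS o') && (oX1 o =? oX1 o') && (oX2 o =? oX2 o') && (oY o =? oY o')))
     by (intros o'; unfold sameV, rvX1X2, rvY, rvS; rewrite !leqb1, !leqb2; btauto).
    rewrite (prob_ext _ _ (fun o' => sameV rvX1X2 o o' && sameV rvS o o')
      (fun o' => (oS o =? oS o') && (oX1 o =? oX1 o') && (oX2 o =? oX2 o')))
      by (intros o'; unfold sameV, rvX1X2, rvS; rewrite !leqb1, !leqb2; btauto).
    rewrite (prob_ext _ _ (fun o' => sameV rvS o o') (fun o' => oS o =? oS o'))
      by (intros o'; apply leqb1).
    fold (probS Om P (oS o)). rewrite probS_jointP, prob_point, prob_SX1X2 by auto.
    assert (0 < Q (oS o) * PX1 (oX1 o) * PX2 (oX2 o) (oX1 o) (oS o)).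
    { rewrite <- prob_SX1X2 by auto. apply Hev. now rewrite !Nat.eqb_refl. }
    assert (0 < prob Om P (fun o' => sameV rvY o o' && sameV rvS o o'))
      by (apply Hev; now rewrite !Hself).
    unfold P at 1, jointP; simpl. field.
    repeat split; try lra; intros E; rewrite E in *; lra. }
  rewrite E1. unfold t2.
  rewrite (prob_ext _ _ (fun o' => sameV rvX1 o o' && sameV rvS o o' && sameV rvY o o')
    (fun o' => (oX1 o =? oX1 o') && (oY o =? oY o') && (oS o =? oS o')))
    by (intros o'; unfold sameV, rvX1, rvY, rvS; rewrite !leqb1; btauto).
  (* The conjuncts are reordered so that this probability is the same term as in [E1] and [field]
     can cancel it. *)
  rewrite (prob_ext _ _ (fun o' => sameV rvS o o' && sameV rvY o o')
    (fun o' => sameV rvY o o' && sameV rvS o o')) by (intros o'; apply andb_comm).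
  rewrite (prob_ext _ _ (fun o' => sameV rvX1 o o' && sameV rvY o o')
    (fun o' => (oX1 o =? oX1 o') && (oY o =? oY o')))
    by (intros o'; unfold sameV, rvX1, rvY; rewrite !leqb1; btauto).
  rewrite (prob_ext _ _ (fun o' => sameV rvY o o') (fun o' => oY o =? oY o'))
    by (intros o'; apply leqb1).
  fold (probY Om P (oY o)). fold (probX1Y Om P (oX1 o) (oY o)).
  fold (probSX1Y Om P (oS o) (oX1 o) (oY o)).
  assert (0 < probY Om P (oY o)) by (apply Hev; now rewrite !Nat.eqb_refl).
  assert (0 < probX1Y Om P (oX1 o) (oY o)) by (apply Hev; now rewrite !Nat.eqb_refl).
  assert (0 < probSX1Y Om P (oS o) (oX1 o) (oY o)) by (apply Hev; now rewrite !Nat.eqb_refl).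
  assert (0 < prob Om P (fun o' => sameV rvY o o' && sameV rvS o o'))
    by (apply Hev; now rewrite !Hself).
  field. repeat split; lra.
Qed.

End SingleLetter.

(** * The time-averaged law of a block code *)

Section BlockCode.

Context (nS nX1 nX2 nY : nat) (Q : nat -> R) (W : nat -> nat -> nat -> nat -> R)
  (HQ : is_pmf nS Q) (HW : is_channel nS nX1 nX2 nY W)
  (n Mc M1 : nat) (Hn : (0 < n)%nat) (HMc : (0 < Mc)%nat) (HM1 : (0 < M1)%nat)
  (HnX2 : (0 < nX2)%nat)
  (phi1 : nat -> nat -> list nat) (phi2 : list nat -> nat -> list nat)
  (psi : list nat -> nat * nat)
  (Hphi1 : forall wc w1, (wc < Mc)%nat -> (w1 < M1)%nat -> valid_seq nX1 n (phi1 wc w1))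
  (Hphi2 : forall s wc, valid_seq nS n s -> (wc < Mc)%nat -> valid_seq nX2 n (phi2 s wc)).

Let msgP := / (INR Mc * INR M1).

Definition msgs := list_prod (seq 0 Mc) (seq 0 M1).

(* (wc, w1, s^n): everything that determines the two channel inputs *)
Definition sources := list_prod msgs (allseqs nS n).

Definition in1 (t : nat * nat * list nat) := phi1 (fst (fst t)) (snd (fst t)).
Definition in2 (t : nat * nat * list nat) := phi2 (snd t) (fst (fst t)).
Definition sourceP (t : nat * nat * list nat) := msgP * Qn Q (snd t).

Definition blocks := list_prod sources (allseqs nY n).
Definition blockP (w : nat * nat * list nat * list nat) :=
  sourceP (fst w) * Wn W n (snd w) (in1 (fst w)) (in2 (fst w)) (snd (fst w)).
Definition letter (w : nat * nat * list nat * list nat) (i : nat) :=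
  mkOutc (nth i (snd (fst w)) O) (nth i (in1 (fst w)) O) (nth i (in2 (fst w)) O)
         (nth i (snd w) O).
Definition decoded (w : nat * nat * list nat * list nat) :=
  (fst (psi (snd w)) =? fst (fst (fst w))) && (snd (psi (snd w)) =? snd (fst (fst w))).

(** The law of the uninformed input at a uniformly random time. It averages over messages only,
    since no state enters this encoder. *)
Definition avgX1 (a : nat) : R :=
  sumR (fun m => sumR (fun i => / INR n * msgP * indic (nth i (phi1 (fst m) (snd m)) O =? a))
    (seq 0 n)) msgs.
(** The joint law of the state and both inputs at a uniformly random time; [avgX2] is its
    conditional law of the informed input. *)
Definition avgSX1X2 (s a b : nat) : R :=
  sumR (fun t => sumR (fun i => / INR n * sourceP t * (indic (nth i (snd t) O =? s) *
    (indic (nth i (in1 t) O =? a) * indic (nth i (in2 t) O =? b)))) (seq 0 n)) sources.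
(* the value off the support of the conditioning pair is an arbitrary pmf *)
Definition avgX2 (b a s : nat) : R :=
  if Req_EM_T (Q s * avgX1 a) 0 then indic (0 =? b) else avgSX1X2 s a b / (Q s * avgX1 a).

Let Om := outcomes nS nX1 nX2 nY.
Let P := jointP Q avgX1 avgX2 W.

Lemma msgP_pos : 0 < msgP.
Proof. apply Rinv_0_lt_compat, Rmult_lt_0_compat; now apply lt_0_INR. Qed.

Lemma INRn_pos : 0 < INR n.
Proof. now apply lt_0_INR. Qed.

Lemma invn_pos : 0 < / INR n.
Proof. apply Rinv_0_lt_compat, INRn_pos. Qed.

Lemma sumR_msgs_const : sumR (fun _ => msgP) msgs = 1.
Proof.
  unfold msgs, msgP. rewrite sumR_const, length_prod, !length_seq, mult_INR.
  apply lt_0_INR in HMc, HM1. field; lra.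
Qed.

Lemma in_msgs m : In m msgs -> (fst m < Mc)%nat /\ (snd m < M1)%nat.
Proof.
  destruct m as [wc w1]. intros H. apply in_prod_iff in H as [H1 H2].
  apply in_seq in H1, H2. simpl. lia.
Qed.

Lemma in_sources t : In t sources ->
  In (fst t) msgs /\ In (snd t) (allseqs nS n) /\ valid_seq nX1 n (in1 t) /\
  valid_seq nX2 n (in2 t).
Proof.
  destruct t as [m s]. intros H. apply in_prod_iff in H as [H1 H2]. simpl.
  destruct (in_msgs m H1). repeat split; auto.
  - now apply Hphi1.
  - now apply Hphi1.
  - apply Hphi2; auto. now apply allseqs_valid.
  - apply Hphi2; auto. now apply allseqs_valid.
Qed.

Lemma sourceP_nonneg t : In t sources -> 0 <= sourceP t.
Proof.
  intros H. apply in_sources in H as (_ & Hs & _). apply Rmult_le_pos.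
  - apply Rlt_le, msgP_pos.
  - now apply (Qn_nonneg nS Q n).
Qed.

(** * Product form of the time-averaged law *)

Lemma avgX1_nonneg a : 0 <= avgX1 a.
Proof.
  apply sumR_nonneg; intros m _. apply sumR_nonneg; intros i _.
  pose proof msgP_pos. pose proof invn_pos. pose proof (indic_nonneg (nth i (phi1 (fst m) (snd m)) O =? a)).
  repeat apply Rmult_le_pos; lra.
Qed.

Lemma avgSX1X2_nonneg s a b : 0 <= avgSX1X2 s a b.
Proof.
  apply sumR_nonneg; intros t Ht. apply sumR_nonneg; intros i _.
  pose proof (sourceP_nonneg t Ht). pose proof invn_pos.
  apply Rmult_le_pos; [apply Rmult_le_pos; [lra|assumption]|].
  repeat apply Rmult_le_pos; apply indic_nonneg.
Qed.

Lemma avgX1_pmf : is_pmf nX1 avgX1.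
Proof.
  split; [intros; apply avgX1_nonneg|]. unfold avgX1. rewrite sumR_exchange.
  rewrite <- sumR_msgs_const. apply sumR_ext_in. intros m Hm. rewrite sumR_exchange.
  transitivity (sumR (fun _ : nat => / INR n * msgP) (seq 0 n)).
  - apply sumR_ext_in. intros i Hi. apply in_seq in Hi. rewrite sumR_scal.
    rewrite (sumR_ext_in _ (fun v => indic (nth i (phi1 (fst m) (snd m)) O =? v) * 1)) by (intros; lra).
    rewrite (sumR_delta (fun _ => 1)); [lra|].
    apply in_msgs in Hm. apply (valid_seq_nth nX1 n); [now apply Hphi1|lia].
  - rewrite sumR_const, length_seq. pose proof INRn_pos. field; lra.
Qed.

(* The uninformed encoder ignores the state, so X1 stays independent of S
   after time averaging. *)
Lemma sumR_avgSX1X2 s a : (s < nS)%nat ->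
  sumR (avgSX1X2 s a) (seq 0 nX2) = Q s * avgX1 a.
Proof.
  intros Hs. unfold avgSX1X2. rewrite sumR_exchange. unfold sources. rewrite sumR_list_prod.
  unfold avgX1. rewrite <- sumR_scal. apply sumR_ext_in. intros m Hm.
  rewrite <- sumR_scal.
  transitivity (sumR (fun x => sumR (fun i => / INR n * msgP * indic (nth i (phi1 (fst m) (snd m)) O =? a)
     * (Qn Q x * indic (nth i x O =? s))) (seq 0 n)) (allseqs nS n)).
  - apply sumR_ext_in. intros x Hx. rewrite sumR_exchange. apply sumR_ext_in. intros i Hi.
    apply in_seq in Hi.
    rewrite <- (sumR_delta (fun _ => / INR n * msgP * indic (nth i (phi1 (fst m) (snd m)) O =? a)
     * (Qn Q x * indic (nth i x O =? s))) nX2 (nth i (in2 (m, x)) O)).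
    + apply sumR_ext_in. intros b _. unfold sourceP, in1; simpl. ring.
    + apply (valid_seq_nth nX2 n); [|lia]. apply in_msgs in Hm.
      apply Hphi2; [|tauto]. now apply allseqs_valid.
  - rewrite sumR_exchange. apply sumR_ext_in. intros i Hi. apply in_seq in Hi.
    (* For a fixed message pair the first input at time [i] is a constant, so averaging over the
       state sequence only involves the marginal [Q] of its [i]-th letter. *)
    rewrite sumR_scal.
    rewrite (sumR_Qn_marginal nS Q n (fun v => indic (v =? s))) by (auto; lia).
    rewrite (sumR_ext_in _ (fun v => indic (s =? v) * Q v)).
    + rewrite (sumR_delta Q) by auto. ring.
    + intros v _. rewrite Nat.eqb_sym. ring.
Qed.

Lemma avgX2_pmf a s : (s < nS)%nat -> is_pmf nX2 (fun b => avgX2 b a s).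
Proof.
  intros Hs. unfold avgX2. destruct (Req_EM_T _ _) as [E|E].
  - split; [intros; apply indic_nonneg|].
    rewrite (sumR_ext_in _ (fun v => indic (0 =? v) * 1)) by (intros; lra).
    now rewrite (sumR_delta (fun _ => 1)).
  - assert (Hp : 0 < Q s * avgX1 a).
    { destruct (Rmult_le_pos (Q s) (avgX1 a)) as [H|H]; auto using avgX1_nonneg.
      - now apply HQ.
      - congruence. }
    split.
    + intros b _. apply Rmult_le_pos; [apply avgSX1X2_nonneg|].
      now apply Rlt_le, Rinv_0_lt_compat.
    + unfold Rdiv. rewrite sumR_scal_r, sumR_avgSX1X2 by auto. field. split; nra.
Qed.

(** The arbitrary choice in [avgX2] does no harm: where [Q s * avgX1 a] vanishes, [avgSX1X2 s a b]
    is one nonnegative term of a sum equal to 0. *)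
Lemma avg_factorization s a b : (s < nS)%nat -> (b < nX2)%nat ->
  Q s * avgX1 a * avgX2 b a s = avgSX1X2 s a b.
Proof.
  intros Hs Hb. unfold avgX2. destruct (Req_EM_T _ _) as [E|E].
  - rewrite E, Rmult_0_l. apply Rle_antisym; [apply avgSX1X2_nonneg|].
    rewrite <- E, <- sumR_avgSX1X2 by auto.
    apply (sumR_ge_term (avgSX1X2 s a)); [intros; apply avgSX1X2_nonneg|apply in_seq; lia].
  - field. split; intros E'; apply E; rewrite E'; ring.
Qed.

(** * Expectations under the averaged law and under the block law *)

Lemma sumR_avgSX1X2_expect (h : nat -> nat -> nat -> R) :
  sumR (fun s => sumR (fun a => sumR (fun b => avgSX1X2 s a b * h s a b)
    (seq 0 nX2)) (seq 0 nX1)) (seq 0 nS) =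
  sumR (fun t => sumR (fun i => / INR n * sourceP t *
    h (nth i (snd t) O) (nth i (in1 t) O) (nth i (in2 t) O)) (seq 0 n)) sources.
Proof.
  (* Packing source and time into [q], and the three letters into [v], reduces the reordering of
     five nested sums to one exchange. The indicators then select the letters actually occurring at
     time [i]. *)
  set (k q v := / INR n * sourceP (fst q) * (indic (nth (snd q) (snd (fst q)) O =? fst (fst v)) *
    (indic (nth (snd q) (in1 (fst q)) O =? snd (fst v)) *
     (indic (nth (snd q) (in2 (fst q)) O =? snd v) * h (fst (fst v)) (snd (fst v)) (snd v))))).
  transitivity (sumR (fun v => sumR (fun q => k q v) (list_prod sources (seq 0 n)))
    (list_prod (list_prod (seq 0 nS) (seq 0 nX1)) (seq 0 nX2))).
  - rewrite !sumR_list_prod. apply sumR_ext_in; intros s _. apply sumR_ext_in; intros a _.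
    apply sumR_ext_in; intros b _. rewrite sumR_list_prod.
    unfold avgSX1X2. rewrite <- sumR_scal_r. apply sumR_ext_in; intros t _.
    rewrite <- sumR_scal_r. apply sumR_ext_in; intros i _. unfold k; simpl. ring.
  - rewrite sumR_exchange, sumR_list_prod. apply sumR_ext_in; intros t Ht.
    apply in_sources in Ht as (_ & Hs & H1 & H2). apply allseqs_valid in Hs.
    apply sumR_ext_in; intros i Hi. apply in_seq in Hi. unfold k; simpl.
    rewrite !sumR_list_prod. simpl.
    rewrite <- (sumR_delta (fun s => / INR n * sourceP t * h s (nth i (in1 t) O) (nth i (in2 t) O))
      nS (nth i (snd t) O)) by (apply (valid_seq_nth nS n); [auto|lia]).
    apply sumR_ext_in; intros s _.
    rewrite <- (sumR_delta (fun a => / INR n * sourceP t * h s a (nth i (in2 t) O))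
      nX1 (nth i (in1 t) O)) by (apply (valid_seq_nth nX1 n); [auto|lia]).
    rewrite <- sumR_scal. apply sumR_ext_in; intros a _.
    rewrite <- (sumR_delta (fun b => / INR n * sourceP t * h s a b)
      nX2 (nth i (in2 t) O)) by (apply (valid_seq_nth nX2 n); [auto|lia]).
    rewrite <- !sumR_scal. apply sumR_ext_in; intros b _. ring.
Qed.

Lemma in_blocks w : In w blocks -> In (fst w) sources /\ In (snd w) (allseqs nY n).
Proof. destruct w as [t y]. apply in_prod_iff. Qed.

Lemma sumR_W_letter t i : In t sources -> (i < n)%nat ->
  sumR (fun y => W y (nth i (in1 t) O) (nth i (in2 t) O) (nth i (snd t) O)) (seq 0 nY) = 1.
Proof.
  intros Ht Hi. apply in_sources in Ht as (_ & Hs & H1 & H2). apply allseqs_valid in Hs.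
  apply HW; eapply valid_seq_nth; eauto.
Qed.

Lemma sumR_Wn t : In t sources ->
  sumR (fun y => Wn W n y (in1 t) (in2 t) (snd t)) (allseqs nY n) = 1.
Proof.
  intros Ht. unfold Wn.
  rewrite (sumR_allseqs_prod nY n
    (fun i v => W v (nth i (in1 t) O) (nth i (in2 t) O) (nth i (snd t) O))).
  apply prodR_1. intros i Hi. apply in_seq in Hi. apply sumR_W_letter; [exact Ht|lia].
Qed.

Lemma letter_in w i : In w blocks -> (i < n)%nat -> In (letter w i) Om.
Proof.
  intros Hw Hi. apply in_blocks in Hw as [Ht Hy].
  apply in_sources in Ht as (_ & Hs & H1 & H2). apply allseqs_valid in Hs, Hy.
  apply in_outcomes. unfold letter; simpl. repeat split; eapply valid_seq_nth; eauto.
Qed.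

Lemma blockP_nonneg w : In w blocks -> 0 <= blockP w.
Proof.
  intros Hw. pose proof (in_blocks w Hw) as [Ht _].
  apply Rmult_le_pos; [now apply sourceP_nonneg|].
  apply prodR_nonneg. intros i Hi. apply in_seq in Hi.
  assert (Ho : In (letter w i) Om) by (apply letter_in; [exact Hw|lia]).
  apply in_outcomes in Ho as (Hs & H1 & H2 & Hy).
  exact (proj1 (HW _ _ _ H1 H2 Hs) _ Hy).
Qed.

Lemma sumR_sourceP : sumR sourceP sources = 1.
Proof.
  unfold sources. rewrite sumR_list_prod, <- sumR_msgs_const.
  apply sumR_ext_in. intros m _. unfold sourceP; simpl.
  rewrite sumR_scal, sumR_Qn by exact HQ. ring.
Qed.

Lemma sumR_blockP : sumR blockP blocks = 1.
Proof.
  unfold blocks. rewrite sumR_list_prod, <- sumR_sourceP.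
  apply sumR_ext_in. intros t Ht. unfold blockP; simpl.
  rewrite sumR_scal, sumR_Wn by exact Ht. ring.
Qed.

(** This passes from single letters to blocks. The factorization replaces the inputs' law by the
    actual time average, and memorylessness makes the output at time [i] have law [W] given the
    letters at time [i], the other outputs summing out to 1. *)
Lemma avg_expect (f : outc -> R) :
  sumR (fun o => P o * f o) Om =
  / INR n * sumR (fun w => blockP w * sumR (fun i => f (letter w i)) (seq 0 n)) blocks.
Proof.
  unfold Om. rewrite sumR_outcomes.
  transitivity (sumR (fun s => sumR (fun a => sumR (fun b => avgSX1X2 s a b *
     sumR (fun y => W y a b s * f (mkOutc s a b y)) (seq 0 nY))
    (seq 0 nX2)) (seq 0 nX1)) (seq 0 nS)).
  - apply sumR_ext_in; intros s Hs. apply sumR_ext_in; intros a _.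
    apply sumR_ext_in; intros b Hb. apply in_seq in Hs, Hb. rewrite <- sumR_scal.
    apply sumR_ext_in; intros y _. unfold P, jointP; simpl.
    rewrite avg_factorization by lia. ring.
  - rewrite (sumR_avgSX1X2_expect
      (fun s a b => sumR (fun y => W y a b s * f (mkOutc s a b y)) (seq 0 nY))).
    unfold blocks. rewrite sumR_list_prod, <- sumR_scal.
    apply sumR_ext_in; intros t Ht.
    transitivity (/ INR n * sumR (fun y => sumR (fun i => sourceP t *
      (Wn W n y (in1 t) (in2 t) (snd t) * f (letter (t, y) i))) (seq 0 n)) (allseqs nY n)).
    + rewrite sumR_exchange, <- sumR_scal. apply sumR_ext_in; intros i Hi. apply in_seq in Hi.
      rewrite sumR_scal, <- Rmult_assoc. f_equal. symmetry.
      apply (sumR_allseqs_marginal nY n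
        (fun i v => W v (nth i (in1 t) O) (nth i (in2 t) O) (nth i (snd t) O))
        (fun v => f (mkOutc (nth i (snd t) O) (nth i (in1 t) O) (nth i (in2 t) O) v)));
        [|lia].
      intros j Hj. now apply sumR_W_letter.
    + f_equal. apply sumR_ext_in; intros y _. rewrite <- sumR_scal.
      apply sumR_ext_in; intros i _. unfold blockP; simpl. ring.
Qed.

(** A block of positive mass contributes to the time average at each of its own letters. Density
    ratios are thus needed only on the support of [P]. *)
Lemma avg_letter_pos w i :
  In w blocks -> (i < n)%nat -> 0 < blockP w -> 0 < P (letter w i).
Proof.
  intros Hw Hi Hp. pose proof (letter_in w i Hw Hi) as Ho.
  set (o := letter w i) in *.
  (* The indicator of the single outcome [o]; its expectation under [P] is [P o]. *)
  set (f o' := indic ((oS o =? oS o') && (oX1 o =? oX1 o') && (oX2 o =? oX2 o') && (oY o =? oY o'))).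
  assert (E : P o = sumR (fun o => P o * f o) Om).
  { pose proof Ho as Hr. apply in_outcomes in Hr as (Hs & Ha & Hb & Hy).
    pose proof (prob_point nS nX1 nX2 nY Q avgX1 avgX2 W _ _ _ _ Hs Ha Hb Hy) as E.
    rewrite prob_indic in E. destruct o as [s a b y]; simpl in *.
    unfold P. rewrite <- E. apply sumR_ext_in. intros o' _. unfold f. ring. }
  rewrite E, avg_expect. apply Rmult_lt_0_compat; [apply invn_pos|].
  assert (Hf : forall w, 0 <= sumR (fun i => f (letter w i)) (seq 0 n))
    by (intros; apply sumR_nonneg; intros; apply indic_nonneg).
  apply Rlt_le_trans with (blockP w * sumR (fun i => f (letter w i)) (seq 0 n)).
  - apply Rmult_lt_0_compat; [exact Hp|].
    apply Rlt_le_trans with (f (letter w i)).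
    + fold o. unfold f. rewrite !Nat.eqb_refl. simpl. lra.
    + apply (sumR_ge_term (fun i => f (letter w i))); [intros; apply indic_nonneg|apply in_seq; lia].
  - apply (sumR_ge_term (fun w => blockP w * sumR (fun i => f (letter w i)) (seq 0 n)));
      [|exact Hw].
    intros v Hv. apply Rmult_le_pos; auto using blockP_nonneg.
Qed.

Lemma sumR_blockP_decoded :
  sumR (fun w => blockP w * indic (decoded w)) blocks =
  1 - err_prob nS nY Q W n Mc M1 phi1 phi2 psi.
Proof.
  assert (E : err_prob nS nY Q W n Mc M1 phi1 phi2 psi =
    sumR (fun w => blockP w * (1 + -1 * indic (decoded w))) blocks).
  { unfold err_prob, blocks, sources, msgs. fold msgP. rewrite !sumR_list_prod, <- sumR_scal.
    apply sumR_ext_in; intros wc _. rewrite <- sumR_scal.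
    apply sumR_ext_in; intros w1 _. rewrite <- sumR_scal.
    apply sumR_ext_in; intros s _. rewrite <- Rmult_assoc, <- sumR_scal.
    apply sumR_ext_in; intros y _. unfold blockP, decoded, sourceP, in1, in2; simpl.
    destruct ((fst (psi y) =? wc) && (snd (psi y) =? w1)); simpl; ring. }
  rewrite E, (sumR_ext_in (fun w => blockP w * (1 + -1 * indic (decoded w)))
    (fun w => blockP w + -1 * (blockP w * indic (decoded w)))) by (intros; ring).
  rewrite sumR_plus, sumR_scal, sumR_blockP. ring.
Qed.

(** The block law has density equal to the product of [f] over the letters with respect to [r]. Its
    logarithm is a sum over time, whose block expectation is [INR n] times a single-letter
    expectation by [avg_expect]; [divergence_test_bound] bounds it below. *)
Lemma avg_converse (base : nat * nat * list nat * list nat -> R) (num rho f : outc -> R) (M : R) :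
  let r w := base w * prodR (fun i => rho (letter w i)) (seq 0 n) in
  0 < M ->
  (forall w, In w blocks -> blockP w = base w * prodR (fun i => num (letter w i)) (seq 0 n)) ->
  (forall w, In w blocks -> 0 <= base w) ->
  (forall o, In o Om -> 0 <= rho o) ->
  (forall o, In o Om -> 0 < P o -> 0 < f o /\ num o = rho o * f o) ->
  sumR r blocks <= 1 ->
  sumR (fun w => r w * indic (decoded w)) blocks <= / M ->
  (1 - err_prob nS nY Q W n Mc M1 phi1 phi2 psi) * ln M - ln 2 <=
  INR n * ln 2 * sumR (fun o => P o * log2 (f o)) Om.
Proof.
  intros r HM Hfac Hbase Hrho Hf Hr1 Hrok.
  assert (Hln2 : 0 < ln 2) by (rewrite <- ln_1; apply ln_increasing; lra).
  replace (INR n * ln 2 * sumR (fun o => P o * log2 (f o)) Om)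
    with (sumR (fun w => blockP w * sumR (fun i => ln (f (letter w i))) (seq 0 n)) blocks).
  - rewrite <- sumR_blockP_decoded.
    apply divergence_test_bound with (r := r); auto using blockP_nonneg, sumR_blockP.
    + intros w Hw. apply Rmult_le_pos; [auto|]. apply prodR_nonneg.
      intros i Hi. apply in_seq in Hi. apply Hrho, letter_in; [exact Hw|lia].
    + intros w Hw Hp.
      assert (Hl : forall i, In i (seq 0 n) -> 0 < f (letter w i) /\
                num (letter w i) = rho (letter w i) * f (letter w i)).
      { intros i Hi. apply in_seq in Hi.
        apply Hf; [apply letter_in|apply avg_letter_pos]; auto; lia. }
      exists (prodR (fun i => f (letter w i)) (seq 0 n)). repeat split.
      * apply prodR_pos. intros; now apply Hl.
      * symmetry. apply ln_prodR. intros; now apply Hl.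
      * rewrite Hfac by exact Hw. unfold r. rewrite Rmult_assoc, <- prodR_mult. f_equal.
        apply prodR_ext_in. intros; now apply Hl.
  - pose proof (avg_expect (fun o => ln (f o))) as E.
    rewrite (sumR_ext_in (fun o => P o * log2 (f o)) (fun o => / ln 2 * (P o * ln (f o)))).
    + rewrite sumR_scal, E. pose proof INRn_pos. field. lra.
    + intros. unfold log2. field. lra.
Qed.

Lemma sumR_decoded_w1 wc y :
  sumR (fun w1 => indic ((fst (psi y) =? wc) && (snd (psi y) =? w1))) (seq 0 M1)
    <= indic (fst (psi y) =? wc).
Proof.
  rewrite (sumR_ext_in _ (fun w1 => indic (fst (psi y) =? wc) * indic (snd (psi y) =? w1)))
    by (intros; apply indic_andb).
  rewrite sumR_scal. pose proof (indic_nonneg (fst (psi y) =? wc)).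
  pose proof (sumR_indic_eqb_le1 (snd (psi y)) M1). nra.
Qed.

Lemma avgP_nonneg o : In o Om -> 0 <= P o.
Proof.
  apply jointP_nonneg; auto using avgX1_pmf. intros; now apply avgX2_pmf.
Qed.

Lemma prob_avgP_nonneg ev : 0 <= prob Om P ev.
Proof. apply prob_nonneg, avgP_nonneg. Qed.

Lemma prob_avgP_pos o ev : In o Om -> 0 < P o -> ev o = true -> 0 < prob Om P ev.
Proof.
  intros Ho Hp E. eapply Rlt_le_trans; [exact Hp|].
  apply prob_ge_point; auto using avgP_nonneg.
Qed.

(** * The individual rate *)

Definition avgY_SX2 s b y := probSX2Y Om P s b y / probSX2 Om P s b.

Lemma avgY_SX2_nonneg s b y : 0 <= avgY_SX2 s b y.
Proof. apply Rdiv_nonneg; apply prob_avgP_nonneg. Qed.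

Lemma sumR_avgY_SX2 s b : sumR (avgY_SX2 s b) (seq 0 nY) <= 1.
Proof.
  unfold avgY_SX2, Rdiv. rewrite sumR_scal_r. unfold probSX2Y. rewrite prob_partition.
  - apply Rdiv_self_le1.
  - intros o Ho. now apply in_outcomes in Ho.
Qed.

Lemma sumR_prod_avgY_SX2 s x :
  sumR (fun y => prodR (fun i => avgY_SX2 (nth i s O) (nth i x O) (nth i y O)) (seq 0 n))
    (allseqs nY n) <= 1.
Proof.
  rewrite (sumR_allseqs_prod nY n (fun i => avgY_SX2 (nth i s O) (nth i x O))).
  apply prodR_le1. intros i _. split; [|apply sumR_avgY_SX2].
  apply sumR_nonneg; intros; apply avgY_SX2_nonneg.
Qed.

(** The informed input is a function of the state and the common message alone. Hence under the
    reference measure the output carries no information on [w1] given these, and the decoder can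
    only guess it. *)
Lemma individual_rate_bound :
  (1 - err_prob nS nY Q W n Mc M1 phi1 phi2 psi) * ln (INR M1) - ln 2 <=
  INR n * ln 2 * cond_mi Om P rvX1 rvY rvSX2.
Proof.
  unfold Om, P. rewrite cond_mi_X1_Y_given_SX2; auto using avgX1_pmf;
    [fold Om; fold P|intros; now apply avgX2_pmf].
  apply (avg_converse (fun w => sourceP (fst w))
    (fun o => W (oY o) (oX1 o) (oX2 o) (oS o))
    (fun o => avgY_SX2 (oS o) (oX2 o) (oY o))).
  - now apply lt_0_INR.
  - reflexivity.
  - intros w Hw. apply sourceP_nonneg. now apply in_blocks in Hw.
  - intros o _. apply avgY_SX2_nonneg.
  - intros o Ho Hp.
    assert (H1 : 0 < probSX2 Om P (oS o) (oX2 o))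
      by (apply (prob_avgP_pos o); auto; now rewrite !Nat.eqb_refl).
    assert (H2 : 0 < probSX2Y Om P (oS o) (oX2 o) (oY o))
      by (apply (prob_avgP_pos o); auto; now rewrite !Nat.eqb_refl).
    split.
    + apply Rdiv_lt_0_compat; [|exact H2]. apply Rmult_lt_0_compat; [|exact H1].
      apply in_outcomes in Ho as (Hs & Ha & Hb & Hy).
      destruct (proj1 (HW _ _ _ Ha Hb Hs) _ Hy) as [H|H]; [exact H|].
      unfold P, jointP in Hp. rewrite <- H in Hp. lra.
    + unfold avgY_SX2. field. lra.
  - unfold blocks. rewrite sumR_list_prod, <- sumR_sourceP. apply sumR_le; intros t Ht.
    simpl. rewrite sumR_scal. pose proof (sourceP_nonneg t Ht).
    pose proof (sumR_prod_avgY_SX2 (snd t) (in2 t)). nra.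
  - unfold blocks, sources, msgs. rewrite !sumR_list_prod.
    (* Each common message receives the share [msgP] of the bound. For a fixed one, the sum over
       [w1] is moved innermost, where only the decoding indicators depend on it and at most one of
       them is 1. *)
    replace (/ INR M1) with (sumR (fun _ => msgP) (seq 0 Mc)).
    2:{ unfold msgP. rewrite sumR_const, length_seq.
        apply lt_0_INR in HMc, HM1. field; lra. }
    apply sumR_le; intros wc _. rewrite sumR_exchange.
    rewrite <- (Rmult_1_r msgP), <- (sumR_Qn nS Q n HQ), <- sumR_scal.
    apply sumR_le; intros s Hs. rewrite sumR_exchange.
    apply Rle_trans with (sumR (fun y => msgP * Qn Q s * prodR (fun i =>
      avgY_SX2 (nth i s O) (nth i (phi2 s wc) O) (nth i y O)) (seq 0 n)) (allseqs nY n)).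
    + apply sumR_le; intros y _. unfold decoded, sourceP, letter, in2; simpl.
      rewrite sumR_scal. rewrite <- (Rmult_1_r (msgP * Qn Q s * _)) at 2.
      apply Rmult_le_compat_l.
      * repeat apply Rmult_le_pos; [apply Rlt_le, msgP_pos|now apply (Qn_nonneg nS Q n)|].
        apply prodR_nonneg; intros; apply avgY_SX2_nonneg.
      * eapply Rle_trans; [apply sumR_decoded_w1|apply indic_le1].
    + rewrite sumR_scal. apply Rle_trans with (msgP * Qn Q s * 1); [|lra].
      apply Rmult_le_compat_l; [|apply sumR_prod_avgY_SX2].
      apply Rmult_le_pos; [apply Rlt_le, msgP_pos|now apply (Qn_nonneg nS Q n)].
Qed.

(** * The sum rate *)

Definition avgS_X1Y s a y := probSX1Y Om P s a y / probX1Y Om P a y.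

Lemma avgS_X1Y_nonneg s a y : 0 <= avgS_X1Y s a y.
Proof. apply Rdiv_nonneg; apply prob_avgP_nonneg. Qed.

Lemma sumR_prod_avgS_X1Y x y :
  sumR (fun s => prodR (fun i => avgS_X1Y (nth i s O) (nth i x O) (nth i y O)) (seq 0 n))
    (allseqs nS n) <= 1.
Proof.
  rewrite (sumR_allseqs_prod nS n (fun i v => avgS_X1Y v (nth i x O) (nth i y O))).
  apply prodR_le1. intros i _. split.
  - apply sumR_nonneg; intros; apply avgS_X1Y_nonneg.
  - unfold avgS_X1Y, Rdiv. rewrite sumR_scal_r. unfold probSX1Y. rewrite prob_partition.
    + apply Rdiv_self_le1.
    + intros o Ho. now apply in_outcomes in Ho.
Qed.

Lemma sumR_probY : sumR (probY Om P) (seq 0 nY) = 1.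
Proof.
  transitivity (prob Om P (fun _ => true)).
  - apply (prob_partition Om P (fun _ => true) oY nY).
    intros o Ho. now apply in_outcomes in Ho.
  - rewrite prob_indic, (sumR_ext_in _ (fun o => P o * 1)) by (intros; simpl; ring).
    rewrite (avg_expect (fun _ => 1)).
    rewrite (sumR_ext_in _ (fun w => INR n * blockP w)).
    + rewrite sumR_scal, sumR_blockP. pose proof INRn_pos. field; lra.
    + intros w _. rewrite sumR_const, length_seq. ring.
Qed.

(** Given messages and output, the state factors of the reference measure have total mass at most 1.
    Summing them out first leaves outputs independent of the messages. The weight [g] serves both
    for the total mass and for the decoding test. *)
Lemma sum_rate_reference_bound (g : nat * nat -> list nat -> R) :
  (forall m y, 0 <= g m y) ->
  sumR (fun w => msgP * prodR (fun i => probY Om P (oY (letter w i)) *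
      avgS_X1Y (oS (letter w i)) (oX1 (letter w i)) (oY (letter w i))) (seq 0 n)
      * g (fst (fst w)) (snd w)) blocks <=
  sumR (fun y => prodR (fun i => probY Om P (nth i y O)) (seq 0 n) *
    (msgP * sumR (fun m => g m y) msgs)) (allseqs nY n).
Proof.
  intros Hg. unfold blocks. rewrite sumR_list_prod, sumR_exchange.
  apply sumR_le; intros y _. unfold sources. rewrite sumR_list_prod, <- !sumR_scal.
  apply sumR_le; intros m _. unfold letter, in1; simpl.
  rewrite (sumR_ext_in _ (fun s => prodR (fun i => probY Om P (nth i y O)) (seq 0 n) *
    (msgP * g m y) * prodR (fun i => avgS_X1Y (nth i s O)
      (nth i (phi1 (fst m) (snd m)) O) (nth i y O)) (seq 0 n)))
    by (intros s _; rewrite prodR_mult; ring).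
  rewrite sumR_scal. rewrite <- Rmult_1_r. apply Rmult_le_compat_l.
  - apply Rmult_le_pos; [apply prodR_nonneg; intros; apply prob_avgP_nonneg|].
    apply Rmult_le_pos; [apply Rlt_le, msgP_pos|apply Hg].
  - apply sumR_prod_avgS_X1Y.
Qed.

Lemma sumR_prod_probY :
  sumR (fun y => prodR (fun i => probY Om P (nth i y O)) (seq 0 n)) (allseqs nY n) = 1.
Proof.
  rewrite (sumR_allseqs_prod nY n (fun _ => probY Om P)).
  apply prodR_1. intros _ _. apply sumR_probY.
Qed.

Lemma sum_rate_bound :
  (1 - err_prob nS nY Q W n Mc M1 phi1 phi2 psi) * ln (INR Mc * INR M1) - ln 2 <=
  INR n * ln 2 * (cond_mi Om P rvX1X2 rvY rvS - cond_mi Om P rvX1 rvS rvY).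
Proof.
  unfold Om, P. rewrite cond_mi_sum_rate; auto using avgX1_pmf;
    [fold Om; fold P|intros; now apply avgX2_pmf].
  apply (avg_converse (fun _ => msgP)
    (fun o => Q (oS o) * W (oY o) (oX1 o) (oX2 o) (oS o))
    (fun o => probY Om P (oY o) * avgS_X1Y (oS o) (oX1 o) (oY o))).
  - apply Rmult_lt_0_compat; now apply lt_0_INR.
  - intros w Hw. apply in_blocks in Hw as [Ht _]. apply in_sources in Ht as (_ & Hs & _).
    unfold blockP, sourceP. rewrite (Qn_nth Q n) by apply (allseqs_valid _ _ _ Hs).
    unfold Wn. rewrite Rmult_assoc, <- prodR_mult. reflexivity.
  - intros. apply Rlt_le, msgP_pos.
  - intros o _. apply Rmult_le_pos; [apply prob_avgP_nonneg|apply avgS_X1Y_nonneg].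
  - intros o Ho Hp.
    assert (H1 : 0 < probY Om P (oY o))
      by (apply (prob_avgP_pos o); auto; now rewrite !Nat.eqb_refl).
    assert (H2 : 0 < probX1Y Om P (oX1 o) (oY o))
      by (apply (prob_avgP_pos o); auto; now rewrite !Nat.eqb_refl).
    assert (H3 : 0 < probSX1Y Om P (oS o) (oX1 o) (oY o))
      by (apply (prob_avgP_pos o); auto; now rewrite !Nat.eqb_refl).
    split.
    + apply Rdiv_lt_0_compat; [|now apply Rmult_lt_0_compat].
      apply in_outcomes in Ho as (Hs & Ha & Hb & Hy).
      destruct (proj1 (HW _ _ _ Ha Hb Hs) _ Hy) as [H|H];
        [|unfold P, jointP in Hp; rewrite <- H in Hp; lra].
      destruct (proj1 HQ _ Hs) as [H'|H'];
        [|unfold P, jointP in Hp; rewrite <- H' in Hp; lra].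
      repeat apply Rmult_lt_0_compat; assumption.
    + unfold avgS_X1Y. field. lra.
  (* Total mass of the reference measure: the weight is the constant 1. *)
  - pose proof (sum_rate_reference_bound (fun _ _ => 1)) as H. simpl in H.
    rewrite sumR_const, (sumR_ext_in _ (fun y =>
      prodR (fun i => probY Om P (nth i y O)) (seq 0 n))), sumR_prod_probY in H.
    + eapply Rle_trans; [|apply H; intros; lra].
      apply Req_le, sumR_ext_in. intros w _. symmetry. apply Rmult_1_r.
    + intros y _. pose proof sumR_msgs_const as E. rewrite sumR_const in E.
      rewrite Rmult_1_r, (Rmult_comm msgP), E. ring.
  (* Decoding test: for each output at most one message pair equals the decoder's answer, so the
     message average of the weight is at most [msgP]. *)
  - eapply Rle_trans; [apply (sum_rate_reference_bound (fun m y =>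
      indic ((fst (psi y) =? fst m) && (snd (psi y) =? snd m)))); intros; apply indic_nonneg|].
    apply Rle_trans with (1 * msgP); [|rewrite Rmult_1_l; apply Rle_refl].
    rewrite <- sumR_prod_probY, <- sumR_scal_r.
    apply sumR_le; intros y _. apply Rmult_le_compat_l;
      [apply prodR_nonneg; intros; apply prob_avgP_nonneg|].
    apply Rle_trans with (msgP * 1); [|lra]. apply Rmult_le_compat_l; [apply Rlt_le, msgP_pos|].
    unfold msgs. rewrite sumR_list_prod.
    eapply Rle_trans; [|apply (sumR_indic_eqb_le1 (fst (psi y)) Mc)].
    apply sumR_le; intros wc _. exact (sumR_decoded_w1 wc y).
Qed.

End BlockCode.

(** * Message counts and the passage to vanishing error *)

(** [Int_part] is the floor, so [- Int_part (- x)] is the ceiling of [x], and [Z.to_nat] never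
    decreases an integer. *)
Lemma msg_size_ge n r : Rpower 2 (INR n * r) <= INR (msg_size n r).
Proof.
  unfold msg_size. set (x := Rpower 2 (INR n * r)).
  pose proof (base_Int_part (- x)) as [H _].
  eapply Rle_trans with (IZR (- Int_part (- x))); [rewrite opp_IZR; lra|].
  rewrite INR_IZR_INZ. apply IZR_le. lia.
Qed.

Lemma msg_size_pos n r : (0 < msg_size n r)%nat.
Proof.
  apply INR_lt. eapply Rlt_le_trans; [|apply msg_size_ge]. apply exp_pos.
Qed.

Lemma ln_msg_size_ge n r : INR n * r * ln 2 <= ln (INR (msg_size n r)).
Proof.
  rewrite <- (ln_exp (INR n * r * ln 2)). destruct (msg_size_ge n r) as [H|H].
  - apply Rlt_le, ln_increasing; [apply exp_pos|exact H].
  - rewrite <- H. apply Rle_refl.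
Qed.

(** Division by [INR n * ln 2] turns the loss of one bit into [/ INR n]. The bound [e <= 1] keeps
    the factor of [lnM] nonnegative when [lnM] is replaced by its lower bound. *)
Lemma rate_le_of_converse n e r lnM I :
  (0 < n)%nat -> e <= 1 -> INR n * r * ln 2 <= lnM ->
  (1 - e) * lnM - ln 2 <= INR n * ln 2 * I -> (1 - e) * r - / INR n <= I.
Proof.
  intros Hn He HM H. apply lt_0_INR in Hn.
  assert (Hln2 : 0 < ln 2) by (rewrite <- ln_1; apply ln_increasing; lra).
  assert (Hc : 0 < INR n * ln 2) by now apply Rmult_lt_0_compat.
  apply (Rmult_le_reg_l (INR n * ln 2)); [exact Hc|].
  replace (INR n * ln 2 * ((1 - e) * r - / INR n))
    with ((1 - e) * (INR n * r * ln 2) - ln 2) by (field; lra).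
  assert ((1 - e) * (INR n * r * ln 2) <= (1 - e) * lnM) by (apply Rmult_le_compat_l; lra).
  lra.
Qed.

Theorem theorem2 (nS nX1 nX2 nY : nat) (Q : nat -> R)
  (W : nat -> nat -> nat -> nat -> R)
  (HQ : is_pmf nS Q) (HW : is_channel nS nX1 nX2 nY W) (Rc R1 : R) :
  capacity_region nS nX1 nX2 nY Q W Rc R1 ->
  closure2 (outer_set nS nX1 nX2 nY Q W) Rc R1.
Proof.
  intros Hcap eps Heps.
  destruct (Hcap (eps / 2)) as (rc & r1 & Hach & Hrc & Hr1); [lra|].
  destruct Hach as (Hrc0 & Hr10 & phi1 & phi2 & psi & Hphi1 & Hphi2 & Herr).
  (* Half of [eps] is spent on approximating by an achievable pair; [eta] is the further loss in
     each rate, half from the error probability and half from [/ INR n]. The minimum with 1 ensures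
     [e <= 1], and the added 1 keeps the denominator positive at zero rates. *)
  set (eta := eps / 4). set (d := Rmin 1 (eta / 2 / (rc + r1 + 1))).
  assert (Hd : 0 < d).
  { apply Rmin_glb_lt; [lra|]. apply Rdiv_lt_0_compat; unfold eta; lra. }
  destruct (Herr d Hd) as [N HN].
  destruct (archimed_cor1 (eta / 2)) as (N' & HN' & HN'0); [unfold eta; lra|].
  set (n := (N + N')%nat).
  assert (Hn : (0 < n)%nat) by lia.
  assert (Hinv : / INR n <= eta / 2).
  { apply Rle_trans with (/ INR N'); [|lra]. apply Rinv_le_contravar.
    - now apply lt_0_INR.
    - apply le_INR. unfold n. lia. }
  specialize (HN n ltac:(unfold n; lia)). unfold R_dist in HN. rewrite Rminus_0_r in HN.
  set (e := err_prob nS nY Q W n (msg_size n rc) (msg_size n r1) (phi1 n) (phi2 n) (psi n)) in *.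
  apply Rabs_def2 in HN as [He _].
  assert (He1 : e <= 1) by (pose proof (Rmin_l 1 (eta / 2 / (rc + r1 + 1))); unfold d in He; lra).
  assert (He2 : e * (rc + r1 + 1) <= eta / 2).
  { pose proof (Rmin_r 1 (eta / 2 / (rc + r1 + 1))) as H. fold d in H.
    replace (eta / 2) with (eta / 2 / (rc + r1 + 1) * (rc + r1 + 1)) by (field; lra).
    apply Rmult_le_compat_r; lra. }
  assert (Heps' : 0 < eta) by (unfold eta; lra).
  assert (Hesmall : forall r, 0 <= r <= rc + r1 -> e * r <= eta / 2).
  { intros r Hr. destruct (Rle_dec 0 e); nra. }
  assert (HnS : (0 < nS)%nat).
  { destruct nS; [destruct HQ as [_ H]; simpl in H; lra|lia]. }
  (* The code maps the valid all-zero state sequence to a word of positive length, so the second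
     input alphabet has a letter. This supports the default pmf in [avgX2]. *)
  assert (HnX2 : (0 < nX2)%nat).
  { assert (Hv : valid_seq nX2 n (phi2 n (repeat O n) O)).
    { apply Hphi2; [|apply msg_size_pos]. split; [apply repeat_length|].
      apply Forall_forall. intros x Hx. apply repeat_spec in Hx. lia. }
    pose proof (valid_seq_nth _ _ _ 0 Hv Hn). lia. }
  pose proof (msg_size_pos n rc) as HMc. pose proof (msg_size_pos n r1) as HM1.
  (* Each converse bound loses at most [eta]: [e * r <= eta / 2] and [/ INR n <= eta / 2]. The sum
     rate has been lowered by [2 * eta], more than required. *)
  exists (rc - eta), (r1 - eta). split.
  - exists (avgX1 n (msg_size n rc) (msg_size n r1) (phi1 n)),
      (avgX2 nS Q n (msg_size n rc) (msg_size n r1) (phi1 n) (phi2 n)).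
    split; [|split; [|split]].
    + eapply avgX1_pmf; eauto.
    + intros x1 s _ Hs. eapply avgX2_pmf; eauto.
    + pose proof (individual_rate_bound nS nX1 nX2 nY Q W HQ HW n _ _ Hn HMc HM1 HnX2
        (phi1 n) (phi2 n) (psi n) (Hphi1 n) (Hphi2 n)) as H.
      eapply rate_le_of_converse in H; [|exact Hn|exact He1|apply ln_msg_size_ge].
      fold e in H. specialize (Hesmall r1 ltac:(lra)). lra.
    + pose proof (sum_rate_bound nS nX1 nX2 nY Q W HQ HW n _ _ Hn HMc HM1 HnX2
        (phi1 n) (phi2 n) (psi n) (Hphi1 n) (Hphi2 n)) as H.
      apply (rate_le_of_converse n e (rc + r1)) in H; [|exact Hn|exact He1|].
      * specialize (Hesmall (rc + r1) ltac:(lra)). lra.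
      * rewrite ln_mult by now apply lt_0_INR.
        pose proof (ln_msg_size_ge n rc). pose proof (ln_msg_size_ge n r1). lra.
  - split.
    + apply Rabs_def2 in Hrc. apply Rabs_def1; unfold eta; lra.
    + apply Rabs_def2 in Hr1. apply Rabs_def1; unfold eta; lra.
Qed.
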